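(* Denote by $K_k$ the clique (complete graph) of size $k$. For every $k\ge1$, the density of $K_k$ in the graphon $W^{(\mathrm{perm})}$ is $$\mathrm{Dens}(K_k,W^{(\mathrm{perm})})=\frac1{k!}.$$
   Context: Let $\Psi=(\Psi_1,\Psi_2):[0,1]\to[0,1]^2$ be any measurable function pushing Lebesgue measure on $[0,1]$ to Lebesgue measure on $[0,1]^2$. $W^{(\mathrm{perm})}$ is the graphon represented by the function $w(x,y)=\mathbb 1[(\Psi_1(x)-\Psi_1(y))(\Psi_2(x)-\Psi_2(y))<0]$ on $[0,1]^2$ (graphons being symmetric measurable functions $[0,1]^2\to[0,1]$ with functions at cut distance $0$ identified; the graphon does not depend on the choice of $\Psi$). For a graphon $W$ with representative $w$, $\mathrm{Sample}_k(W)$ is the unlabeled random graph with $k$ vertices $v_1,\dots,v_k$ obtained by taking $X_1,\dots,X_k$ i.i.d. uniform in $[0,1]$ and connecting $v_i$ and $v_j$ with probability $w(X_i,X_j)$ (independently for distinct pairs conditionally on $(X_1,\dots,X_k)$). For a graph $g$ with $k$ vertices, $\mathrm{Dens}(g,W)=\mathbb P(\mathrm{Sample}_k(W)=g)$. *)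

(* Defs.v *)
From HB Require Import structures.
From mathcomp Require Import all_boot all_order all_algebra all_fingroup.
From mathcomp Require Import all_classical all_reals all_analysis.
From mathcomp Require Import measurable_realfun.

Set Implicit Arguments.
Unset Strict Implicit.
Unset Printing Implicit Defensive.
Import Order.TTheory GRing.Theory Num.Theory.
Import numFieldNormedType.Exports.

Local Open Scope classical_set_scope.
Local Open Scope ring_scope.

Definition I01 (R : realType) := {x : R | 0 <= x <= 1}.

Section unit_interval.
Context {R : realType}.

HB.instance Definition _ := Choice.copy (I01 R) {x : R | 0 <= x <= 1}.
HB.instance Definition _ := isPointed.Build (I01 R)
  (exist (fun x : R => 0 <= x <= 1) 0
     (introT andP (conj (lexx 0) ler01))).

Definition val01 (x : I01 R) : R := sval x.

Lemma val01_inj : injective val01.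
Proof. exact: val_inj. Qed.

Definition I01_display : measure_display.
Proof. by constructor. Qed.

(* Borel subsets of [0,1]. *)
Definition measurable01 : set (set (I01 R)) :=
  preimage_set_system setT val01 measurable.

Let measurable01_sigma : sigma_algebra setT measurable01.
Proof.
exact: sigma_algebra_preimage (@sigma_algebra_measurable _ (measurableTypeR R)).
Qed.

Let measurable01_0 : measurable01 set0.
Proof. by case: measurable01_sigma. Qed.

Let measurable01_C A : measurable01 A -> measurable01 (~` A).
Proof. by case: measurable01_sigma => _ + _ => /[apply]; rewrite setTD. Qed.

Let measurable01_U (F : (set (I01 R))^nat) :
  (forall i, measurable01 (F i)) -> measurable01 (\bigcup_i F i).
Proof. by case: measurable01_sigma => _ _; apply. Qed.

HB.instance Definition _ := @isMeasurable.Build I01_display (I01 R)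
  measurable01 measurable01_0 measurable01_C measurable01_U.

Lemma val01_image_preimage (B : set R) :
  val01 @` (val01 @^-1` B) = `[0, 1] `&` B.
Proof.
apply/seteqP; split=> [_ [x Bx <-]|r [r01 Br]].
  by split => //=; rewrite in_itv/=; case: x {Bx}.
have r01' : 0 <= r <= 1 by move: r01; rewrite /= in_itv.
by exists (exist _ r r01').
Qed.

Lemma measurable_val01_image (A : set (I01 R)) :
  measurable A -> measurable (val01 @` A : set (measurableTypeR R)).
Proof.
move=> [B mB <-]; rewrite setTI val01_image_preimage.
by apply: measurableI.
Qed.

Definition lebesgue01 (A : set (I01 R)) : \bar R :=
  lebesgue_measure (val01 @` A).

Let lebesgue01_0 : lebesgue01 set0 = 0%E.
Proof. by rewrite /lebesgue01 image_set0 measure0. Qed.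

Let lebesgue01_ge0 A : (0 <= lebesgue01 A)%E.
Proof. exact: measure_ge0. Qed.

Let lebesgue01_sigma_additive : semi_sigma_additive lebesgue01.
Proof.
move=> F mF tF mUF; rewrite /lebesgue01 image_bigcup.
apply: measure_semi_sigma_additive => [i||].
- exact: measurable_val01_image.
- apply/trivIsetP => i j _ _ ij; apply/eqP.
  move/trivIsetP : tF => /(_ i j I I ij) Fij.
  apply/negPn/negP => /set0P[_ [[x Fix <-] [y Fjy /val01_inj yx]]].
  by rewrite -[False]/(set0 x) -Fij; split => //; rewrite -yx.
- by rewrite -image_bigcup; exact: measurable_val01_image.
Qed.

HB.instance Definition _ := isMeasure.Build _ _ _ lebesgue01
  lebesgue01_0 lebesgue01_ge0 lebesgue01_sigma_additive.

Let lebesgue01_setT : lebesgue01 setT = 1%E.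
Proof.
rewrite /lebesgue01 -(preimage_setT val01) val01_image_preimage setIT.
by rewrite lebesgue_measure_itv/= lte_fin ltr01 oppr0 adde0.
Qed.

HB.instance Definition _ :=
  @Measure_isProbability.Build _ _ R lebesgue01 lebesgue01_setT.

Lemma measurable_val01 : measurable_fun [set: I01 R] val01.
Proof. by move=> _ B mB; exists B. Qed.

End unit_interval.

(* Law of n independent points with common law P, as a tuple. *)
Section iid.
Context d (T : measurableType d) (R : realType) (P : probability T R).

Definition cons_tuple n (z : T * n.-tuple T) : n.+1.-tuple T :=
  [the n.+1.-tuple T of z.1 :: z.2].

Lemma measurable_cons_tuple n : measurable_fun setT (@cons_tuple n).
Proof. by apply: measurable_cons. Qed.

HB.instance Definition _ n :=
  isMeasurableFun.Build _ _ _ _ (@cons_tuple n) (@measurable_cons_tuple n).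

Fixpoint iid n : probability (n.-tuple T) R :=
  match n with
  | 0 => @dirac _ (0.-tuple T) [tuple] R
  | m.+1 => distribution (P \x iid m)%E (@cons_tuple m)
  end.

End iid.

Record graphon_fun (R : realType) := GraphonFun {
  graphon_val :> I01 R -> I01 R -> R;
  graphon_measurable : measurable_fun setT (fun z => graphon_val z.1 z.2);
  graphon_sym : forall x y, graphon_val x y = graphon_val y x;
  graphon_01 : forall x y, 0 <= graphon_val x y <= 1 }.

Section cut_distance.
Context {R : realType}.
Local Notation lambda := (@lebesgue01 R).

Definition cut_norm (u : I01 R -> I01 R -> R) : \bar R :=
  ereal_sup [set `|\int[lambda \x lambda]_(z in ST.1 `*` ST.2) (u z.1 z.2)%:E|%E
            | ST in [set ST : set (I01 R) * set (I01 R) |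
                      measurable ST.1 /\ measurable ST.2]].

Definition measure_preserving_bij (phi : I01 R -> I01 R) : Prop :=
  [/\ measurable_fun setT phi, bijective phi &
      forall A, measurable A -> lambda (phi @^-1` A) = lambda A].

Definition cut_distance (w w' : graphon_fun R) : \bar R :=
  ereal_inf [set cut_norm (fun x y => w x y - w' (phi x) (phi y))
            | phi in measure_preserving_bij].

(* A graphon is a class of representatives at cut distance 0 of each other. *)
Definition graphon_of (w : graphon_fun R) : set (graphon_fun R) :=
  [set w' | cut_distance w w' = 0%E].

End cut_distance.

Record sgraph (k : nat) := SGraph {
  adj :> rel 'I_k;
  adj_sym : symmetric adj;
  adj_irr : irreflexive adj }.

(* Equality of the underlying unlabeled graphs. *)
Definition graph_iso k (g h : sgraph k) : Prop :=
  exists s : {perm 'I_k}, forall i j, g (s i) (s j) = h i j.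

Section complete_graph.
Variable k : nat.

Let neq_sym : symmetric (fun i j : 'I_k => i != j).
Proof. by move=> i j; rewrite eq_sym. Qed.

Let neq_irr : irreflexive (fun i j : 'I_k => i != j).
Proof. by move=> i; rewrite eqxx. Qed.

Definition complete_graph : sgraph k := SGraph neq_sym neq_irr.

End complete_graph.

Section sample.
Context {R : realType} (k : nat).

(* A sample point is (X, U): X_i is the position of v_i, and the coins U_ij,  *)
(* i < j, are uniform on [0,1] and independent, so that, given X, the events  *)
(* U_ij < w(X_i, X_j) are independent with probability w(X_i, X_j).           *)
Definition sample_space : Type :=
  (k.-tuple (I01 R) * k.-tuple (k.-tuple (I01 R)))%type.

Definition sample_prob :=
  (iid (@lebesgue01 R) k \x iid (iid (@lebesgue01 R) k) k)%E.

Definition connect_lt (w : graphon_fun R) (o : sample_space) (i j : 'I_k) : bool :=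
  (i < j)%N &&
  (val01 (tnth (tnth o.2 i) j) < w (tnth o.1 i) (tnth o.1 j)).

Definition sample_adj (w : graphon_fun R) (o : sample_space) : rel 'I_k :=
  fun i j => connect_lt w o i j || connect_lt w o j i.

Let sample_adj_sym w o : symmetric (sample_adj w o).
Proof. by move=> i j; rewrite /sample_adj orbC. Qed.

Let sample_adj_irr w o : irreflexive (sample_adj w o).
Proof. by move=> i; rewrite /sample_adj /connect_lt ltnn. Qed.

Definition Sample (w : graphon_fun R) (o : sample_space) : sgraph k :=
  SGraph (sample_adj_sym w o) (sample_adj_irr w o).

Definition Dens (g : sgraph k) (w : graphon_fun R) : \bar R :=
  sample_prob [set o | graph_iso (Sample w o) g].

End sample.

Section permutation_graphon.
Context {R : realType} (Psi : {mfun I01 R >-> (I01 R * I01 R)%type}).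

Definition perm_fun (x y : I01 R) : R :=
  (((val01 (Psi x).1 - val01 (Psi y).1) *
    (val01 (Psi x).2 - val01 (Psi y).2) < 0)%R)%:R.

Let perm_fun_measurable : measurable_fun setT (fun z => perm_fun z.1 z.2).
Proof.
have mv (p : I01 R * I01 R -> I01 R) (q : I01 R * I01 R -> I01 R) :
  measurable_fun setT p -> measurable_fun setT q ->
  measurable_fun setT (fun z => val01 (p (Psi (q z)))).
  move=> mp mq; apply: (measurableT_comp measurable_val01).
  by apply: (measurableT_comp mp); apply: measurableT_comp mq.
rewrite (_ : (fun z => _) = (fun z : I01 R * I01 R =>
  if (val01 (Psi z.1).1 - val01 (Psi z.2).1) *
     (val01 (Psi z.1).2 - val01 (Psi z.2).2) < 0 then 1 else 0)); last first.
  by apply/funext => z; rewrite /perm_fun; case: ifP.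
apply: measurable_fun_ifT => //; apply: measurable_fun_ltr => //.
by apply: measurable_funM; apply: measurable_funB; exact: mv.
Qed.

Let perm_fun_sym x y : perm_fun x y = perm_fun y x.
Proof. by rewrite /perm_fun -mulrNN !opprB. Qed.

Let perm_fun_01 x y : 0 <= perm_fun x y <= 1.
Proof. by rewrite /perm_fun ler0n lern1 leq_b1. Qed.

Definition perm_graphon : graphon_fun R :=
  GraphonFun perm_fun_measurable perm_fun_sym perm_fun_01.

End permutation_graphon.

(* Main.v *)
From HB Require Import structures.
Require Import Defs.
From mathcomp Require Import all_boot all_order all_algebra all_fingroup.
From mathcomp Require Import all_classical all_reals all_analysis.
From mathcomp Require Import measurable_realfun.

Set Implicit Arguments.
Unset Strict Implicit.
Unset Printing Implicit Defensive.

Import Order.TTheory GRing.Theory Num.Theory.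
Local Open Scope classical_set_scope.
Local Open Scope ring_scope.

(** The proof has two halves.

    The representative w is only known to be at cut distance 0 from the
    permutation graphon, so the density has to be transferred.  Integrating the
    edge coins out (Dens_complete_graph), the density of K_k in w is the integral
    over k independent uniform points of the product of w(X_i, X_j) over i < j.
    This integral moves by at most k^2 * eps when w is replaced by a graphon
    whose integrals over all measurable rectangles differ from those of w by at
    most eps (clique_density_cut_le): exchange the factors one at a time and,
    when the factor of the pair (i, j) is exchanged, freeze all the points but
    X_i and X_j.  The other factors then split as f(X_i) g(X_j), and the layer
    cake formula writes f and g as averages of indicators, which brings one back
    to rectangles (cut_le_weighted).  The infimum in the cut distance runs over
    measure-preserving rearrangements phi of w, and it need not be attained, so
    this bound is applied to a rearrangement within any given eps; rearranging
    does not change the density (clique_density_pullback).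

    For the permutation graphon, k independent uniform points sent through Psi
    are k independent uniform points of the square, and the density is the
    probability that the ordinates are in the order opposite to the abscissas.
    Abscissas are independent of ordinates, so permuting the ordinates by any
    fixed permutation s preserves the law (iid_recombine).  Almost surely exactly
    one s puts the ordinates in the order opposite to the abscissas
    (reversing_exists, reversing_unique, reversed_cover), hence k! events of
    equal probability partition the space up to a null set.

    Every identity between laws of tuples used on the way comes from the fact
    that iid P n is the only measure giving the box A_1 x ... x A_n the mass
    P(A_1) ... P(A_n) (iid_unique, iid_pushforward). *)

(** * Product laws are determined by boxes *)

Section box.
Context {d : measure_display} {T : measurableType d} {n : nat}.

Definition box (A : 'I_n -> set T) : set (n.-tuple T) :=
  [set t | forall i, A i (tnth t i)].

Lemma measurable_box (A : 'I_n -> set T) :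
  (forall i, measurable (A i)) -> measurable (box A).
Proof.
move=> mA; rewrite (_ : box A = \bigcap_(i in setT) ((@tnth n T)^~ i @^-1` A i)).
  apply: fin_bigcap_measurable => // i _; rewrite -[X in measurable X]setTI.
  exact: measurable_tnth.
by apply/seteqP; split=> [t At i _|t At i]; exact: At.
Qed.

(** Boxes with sides in a generating family already generate: a cylinder is a
    box all of whose sides but one are the whole space, which is why the family
    must contain setT. *)
Lemma measurable_tuple_boxes (G : set_system T) :
  measurable = <<s G >> -> G setT ->
  @measurable _ (n.-tuple T) =
  <<s [set box A | A in [set A : 'I_n -> set T | forall i, G (A i)]] >>.
Proof.
move=> mG GT; set B := (X in <<s X >>); apply/seteqP; split; last first.
  apply: smallest_sub; first exact: sigma_algebra_measurable.
  move=> _ [A GA <-]; apply: measurable_box => i; rewrite mG.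
  exact: sub_sigma_algebra.
apply: smallest_sub; first exact: smallest_sigma_algebra.
move=> C0 /=; rewrite -bigcup_seq => -[i _ [C mC <-]]; rewrite setTI.
pose S := [set C : set T | <<s B >> ((@tnth n T)^~ i @^-1` C)].
suff : <<s G >> `<=` S by apply; rewrite -mG.
apply: smallest_sub; first split.
- by rewrite /S/= preimage_set0; exact: sigma_algebra0.
- by move=> A SA; rewrite /S/= setTD preimage_setC; exact: sigma_algebraC.
- by move=> F SF; rewrite /S/= preimage_bigcup; exact: sigma_algebra_bigcup.
move=> A GA; apply: sub_sigma_algebra.
exists (fun j => if j == i then A else setT); first by move=> j /=; case: ifP.
apply/seteqP; split=> [t /(_ i)|t At j]; first by rewrite eqxx.
by case: eqP => // ->.
Qed.

End box.

Section iid_law.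
Context {d : measure_display} {T : measurableType d} {R : realType}.
Variable P : probability T R.

Lemma iid_box (n : nat) (A : 'I_n -> set T) : (forall i, measurable (A i)) ->
  iid P n (box A) = (\prod_(i < n) P (A i))%E.
Proof.
elim: n A => [|n IH] A mA.
  rewrite big_ord0 [LHS]diracE mem_set//.
  by case.
rewrite big_ord_recl -IH; last by move=> i; exact: mA.
transitivity ((P \x iid P n)%E (A ord0 `*` box (fun i => A (lift ord0 i)))).
  2: by apply: product_measure1E => //; exact: measurable_box.
congr ((P \x iid P n)%E _); apply/seteqP; split=> -[x t] /=.
  move=> At; split=> [|i] /=; first exact: (At ord0).
  by have := At (lift ord0 i); rewrite tnthS.
move=> [Ax At] i; case: (unliftP ord0 i) => [j ->|->]; last exact: Ax.
by rewrite tnthS; exact: At.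
Qed.

(** The sides may be restricted to a generating pi-system G; on a product space
    this allows the sides themselves to be rectangles. *)
Lemma iid_unique (n : nat) (G : set_system T)
    (m : {measure set (n.-tuple T) -> \bar R}) :
  measurable = <<s G >> -> setI_closed G -> G setT ->
  (forall A : 'I_n -> set T, (forall i, G (A i)) ->
     m (box A) = (\prod_(i < n) P (A i))%E) ->
  forall E, measurable E -> iid P n E = m E.
Proof.
move=> mG GI GT mbox E mE.
have Gm A : G A -> measurable A by rewrite mG; exact: sub_sigma_algebra.
apply: (measure_unique
  [set box A | A in [set A : 'I_n -> set T | forall i, G (A i)]]
  (fun=> setT)) => //.
- exact: measurable_tuple_boxes.
- move=> _ _ [A GA <-] [B GB <-]; exists (fun i => A i `&` B i) => /=.
    by move=> i; exact: GI.
  apply/seteqP; split=> [t AB|t [tA tB] i]; last by split.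
  by split=> i; case: (AB i).
- by move=> _; exists (fun=> setT) => //; apply/seteqP; split.
- by apply/seteqP; split => // t _; exists 0%N.
- move=> _ [A GA <-]; transitivity (\prod_(i < n) P (A i))%E.
    by apply: iid_box => i; exact/Gm.
  by rewrite mbox.
- by move=> k /=; rewrite (probability_setT (iid P n)) ltry.
Qed.

End iid_law.

(** * Transporting and resampling independent points *)

Section iid_transfer.
Context {d d' : measure_display} {T : measurableType d} {S : measurableType d'}.
Context {R : realType}.
Variable P : probability T R.

(** The form in which uniqueness is used: a map pushes Q to iid P n as soon as
    the preimages of boxes have the right mass. *)
Lemma iid_pushforward (Q : probability S R) (n : nat) (G : set_system T)
    (f : S -> n.-tuple T) :
  measurable_fun setT f ->
  measurable = <<s G >> -> setI_closed G -> G setT ->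
  (forall A : 'I_n -> set T, (forall i, G (A i)) ->
     Q (f @^-1` box A) = (\prod_(i < n) P (A i))%E) ->
  forall E, measurable E -> Q (f @^-1` E) = iid P n E.
Proof.
move=> mf mG GI GT fbox E mE.
pose F : {mfun S >-> n.-tuple T} :=
  HB.pack f (isMeasurableFun.Build _ _ _ _ f mf).
by rewrite (iid_unique (m := distribution Q F) mG).
Qed.

Lemma iid_pushforwardT (Q : probability S R) (n : nat) (f : S -> n.-tuple T) :
  measurable_fun setT f ->
  (forall A : 'I_n -> set T, (forall i, measurable (A i)) ->
     Q (f @^-1` box A) = (\prod_(i < n) P (A i))%E) ->
  forall E, measurable E -> Q (f @^-1` E) = iid P n E.
Proof.
move=> mf fbox; apply: (iid_pushforward (G := measurable)) => //.
- by rewrite sigma_algebra_id//; exact: sigma_algebra_measurable.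
- exact: measurableI.
Qed.

End iid_transfer.

Lemma measurable_map_tuple (d d' : measure_display) (T : measurableType d)
    (U : measurableType d') (f : T -> U) (n : nat) : measurable_fun setT f ->
  measurable_fun setT (fun t : n.-tuple T => [tuple of map f t]).
Proof.
move=> mf; apply/measurable_fun_tnthP => i.
rewrite (_ : _ \o _ = f \o (fun t => tnth t i)); last first.
  by apply/funext => t /=; rewrite tnth_map.
exact: (measurableT_comp mf (measurable_tnth i)).
Qed.

Lemma iid_map (d d' : measure_display) (T : measurableType d)
    (U : measurableType d') (R : realType) (P : probability T R)
    (Q : probability U R) (f : T -> U) (n : nat) :
  measurable_fun setT f ->
  (forall A, measurable A -> P (f @^-1` A) = Q A) ->
  forall E : set (n.-tuple U), measurable E ->
    iid P n ((fun t : n.-tuple T => [tuple of map f t]) @^-1` E) = iid Q n E.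
Proof.
move=> mf PQ; apply: iid_pushforwardT; first exact: measurable_map_tuple.
move=> A mA; under eq_bigr do rewrite -PQ//.
rewrite -iid_box; last first.
  by move=> i; rewrite -[X in measurable X]setTI; exact: mf.
by congr (iid P n _); apply/seteqP; split=> t At i; have := At i; rewrite tnth_map.
Qed.

Section resample.
Context {d : measure_display} {T : measurableType d} {R : realType}.
Variables (P : probability T R) (n : nat).
Implicit Types (t : n.-tuple T) (i j : 'I_n) (x : T).

Definition set_tnth t i x : n.-tuple T :=
  [tuple if j == i then x else tnth t j | j < n].

Lemma tnth_set_tnth t i x j :
  tnth (set_tnth t i x) j = if j == i then x else tnth t j.
Proof. by rewrite tnth_mktuple. Qed.

Lemma measurable_set_tnth i :
  measurable_fun setT (fun z : n.-tuple T * T => set_tnth z.1 i z.2).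
Proof.
apply/measurable_fun_tnthP => j.
rewrite (_ : _ \o _ = fun z : n.-tuple T * T =>
    if j == i then z.2 else tnth z.1 j); last first.
  by apply/funext => z /=; rewrite tnth_set_tnth.
case: (j == i); first exact: measurable_snd.
exact: (measurableT_comp (measurable_tnth j) measurable_fst).
Qed.

(** Replacing one of n independent points by a fresh independent one does not
    change their joint law.  This isolates a coordinate by Fubini without any
    decomposition of the index set. *)
Lemma iid_resample i (E : set (n.-tuple T)) : measurable E ->
  (iid P n \x P)%E ((fun z => set_tnth z.1 i z.2) @^-1` E) = iid P n E.
Proof.
move: E; apply: (iid_pushforwardT (Q := [the probability _ _ of (iid P n \x P)%E])).
  exact: measurable_set_tnth.
move=> A mA.
pose A' j := if j == i then setT else A j.
have mA' j : measurable (A' j) by rewrite /A'; case: ifP.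
transitivity ((iid P n \x P)%E (box A' `*` A i)).
  congr ((iid P n \x P)%E _); apply/seteqP; split=> -[t x] /=.
    move=> At; split=> [j|]; last by have := At i; rewrite tnth_set_tnth eqxx.
    by have := At j; rewrite tnth_set_tnth /A'; case: ifP.
  move=> [At Ax] j; rewrite tnth_set_tnth; have := At j; rewrite /A'.
  by case: eqP => // ->.
rewrite product_measure1E//; last exact: measurable_box.
rewrite [X in (X * _)%E]iid_box// (bigD1 i)//= [RHS](bigD1 i)//= muleC.
rewrite {1}/A' eqxx probability_setT mul1e; congr (_ * _)%E.
by apply: eq_bigr => j /negbTE; rewrite /A' => ->.
Qed.

Local Open Scope ereal_scope.

Lemma integral_resample i (F : n.-tuple T -> \bar R) :
  measurable_fun setT F -> (forall t, 0 <= F t) ->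
  \int[iid P n]_t F t = \int[iid P n]_t \int[P]_x F (set_tnth t i x).
Proof.
move=> mF F0.
rewrite -(fubini_tonelli1 (fun z => F (set_tnth z.1 i z.2)))//; last first.
  by apply: measurableT_comp => //; exact: measurable_set_tnth.
transitivity (\int[pushforward (iid P n \x P) (fun z => set_tnth z.1 i z.2)]_t F t).
  apply: eq_measure_integral => [|mf A mA _]; first exact: measurable_set_tnth.
  by rewrite -[LHS](iid_resample i mA).
rewrite ge0_integral_pushforward//; exact: measurable_set_tnth.
Qed.

End resample.

(** * The density of a clique as an integral *)

Section clique_density.
Context {R : realType}.
Local Notation lambda := (@lebesgue01 R).

Lemma lebesgue01_lt (c : R) : 0 <= c <= 1 ->
  lambda [set u | val01 u < c] = c%:E.
Proof.
move=> /andP[c0 c1]; rewrite /lebesgue01.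
rewrite (_ : [set _ | _] = val01 @^-1` [set` `]-oo, c[%R]); last first.
  by apply/seteqP; split=> u /=; rewrite in_itv.
rewrite val01_image_preimage (_ : _ `&` _ = [set` `[0%R, c[%R]).
  by rewrite lebesgue_measure_itv/= lte_fin; case: ltgtP c0 => // [c0|<-];
    rewrite ?oppr0 ?adde0.
apply/seteqP; split=> x /=; rewrite !in_itv/=.
  by move=> [/andP[-> _] ->].
by move=> /andP[-> xc]; split=> //; rewrite (le_trans (ltW xc)).
Qed.

Lemma measurable_val01_lt (c : R) : measurable [set u : I01 R | val01 u < c].
Proof.
rewrite (_ : [set _ | _] = setT `&` val01 @^-1` [set` `]-oo, c[%R]).
  exact: measurable_val01.
by apply/seteqP; split=> u /=; rewrite in_itv//=; case.
Qed.

Context {k : nat}.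
Implicit Types (W : 'I_k * 'I_k -> graphon_fun R) (t : k.-tuple (I01 R)).

(** Each pair of vertices carries its own graphon, so that the graphon can be
    exchanged one pair at a time. *)
Definition edge_prod W t : R :=
  \prod_(e : 'I_k * 'I_k | (e.1 < e.2)%N) W e (tnth t e.1) (tnth t e.2).

Definition clique_density W : \bar R :=
  (\int[iid lambda k]_t (edge_prod W t)%:E)%E.

Lemma measurable_graphon_comp d (T : measurableType d) (w : graphon_fun R)
    (f g : T -> I01 R) : measurable_fun setT f -> measurable_fun setT g ->
  measurable_fun setT (fun x => w (f x) (g x)).
Proof.
move=> mf mg.
exact: (measurableT_comp (graphon_measurable w) (measurable_fun_pair mf mg)).
Qed.

Lemma measurable_edge_prod W : measurable_fun setT (edge_prod W).
Proof.
rewrite /edge_prod; under eq_fun do rewrite big_mkcond.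
apply: measurable_prod => e _; case: (e.1 < e.2)%N; last exact: measurable_cst.
by apply: measurable_graphon_comp; exact: measurable_tnth.
Qed.

Lemma edge_prod_ge0 W t : 0 <= edge_prod W t.
Proof.
apply: prodr_ge0 => e _.
by case/andP: (graphon_01 (W e) (tnth t e.1) (tnth t e.2)).
Qed.

(** For fixed positions X, the sample is complete iff each coin U_ij with i < j
    is below w(X_i, X_j), which makes the set of admissible coins a box of
    boxes. *)
Lemma Dens_complete_graph (w : graphon_fun R) :
  Dens (complete_graph k) w = clique_density (fun=> w).
Proof.
apply: eq_integral => t _ /=.
pose C (i j : 'I_k) : set (I01 R) := if (i < j)%N then
  [set u | val01 u < w (tnth t i) (tnth t j)] else setT.
have mC i j : measurable (C i j).
  by rewrite /C; case: ifP => // _; exact: measurable_val01_lt.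
have mbC i : measurable (box (C i)) by exact: measurable_box.
transitivity (iid (iid lambda k) k (box (fun i => box (C i)))).
  congr (iid (iid lambda k) k _); apply/seteqP; split=> U.
    rewrite /xsection/= inE => -[s gs] i j; rewrite /C; case: ifPn => //= ij.
    have := gs (s^-1 i)%g (s^-1 j)%g; rewrite !permKV/= (inj_eq perm_inj).
    rewrite (_ : i != j); last by rewrite -val_eqE/= ltn_eqF.
    by rewrite /sample_adj /connect_lt/= ij ltnNge (ltnW ij)/= orbF.
  move=> CU; rewrite /xsection/= inE; exists 1%g => i j; rewrite !perm1/=.
  rewrite /sample_adj /connect_lt/=.
  have [ij|ji|/val_inj ->] := ltngtP i j; last by rewrite eqxx.
    by have := CU i j; rewrite /C ij/= => ->; rewrite -val_eqE/= ltn_eqF.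
  by have := CU j i; rewrite /C ji/= => ->; rewrite -val_eqE/= gtn_eqF.
rewrite [LHS]iid_box//.
rewrite (eq_bigr (fun i => \prod_(j < k) lambda (C i j))%E); last first.
  by move=> i _; exact: iid_box.
rewrite pair_bigA/= /edge_prod -prodEFin [RHS]big_mkcond/=; apply: eq_bigr => e _.
rewrite /C; case: ifP => _; last exact: probability_setT.
exact/lebesgue01_lt/graphon_01.
Qed.

End clique_density.

(** * Counting lemma: cut distance controls clique densities *)

Definition lebesgue01_square (R : realType) :
  probability (I01 R * I01 R)%type R := (@lebesgue01 R \x @lebesgue01 R)%E.

Section counting.
Context {R : realType}.
Local Notation lambda := (@lebesgue01 R).
Local Notation lambda2 := (lebesgue01_square R).

(** A one-sided comparison, free of signed integrals: the counting argument
    then only involves nonnegative functions, for which Tonelli's theorem applies. *)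
Definition cut_le (eps : R) (u v : graphon_fun R) : Prop :=
  forall S T : set (I01 R), measurable S -> measurable T ->
  (\int[lambda2]_(z in S `*` T) (u z.1 z.2)%:E <=
   \int[lambda2]_(z in S `*` T) (v z.1 z.2)%:E + eps%:E)%E.

Section weighted.
Variables f g : I01 R -> R.
Hypotheses (mf : measurable_fun setT f) (mg : measurable_fun setT g).
Hypotheses (f01 : forall x, 0 <= f x <= 1) (g01 : forall x, 0 <= g x <= 1).

(** For a fixed z, the levels q at which the value of u is kept form a rectangle
    of area f(z.1) g(z.2); for a fixed q, the points z at which it is kept form a
    rectangle too. *)
Let layer (u : graphon_fun R) (z q : I01 R * I01 R) : \bar R :=
  if (val01 q.1 < f z.1) && (val01 q.2 < g z.2) then (u z.1 z.2)%:E else 0%E.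

Let layer_ge0 u z q : (0 <= layer u z q)%E.
Proof.
rewrite /layer; case: ifP => // _; rewrite lee_fin.
by case/andP: (graphon_01 u z.1 z.2).
Qed.

Local Notation square := (I01 R * I01 R)%type.

Let measurable_layer u : measurable_fun setT (fun zq => layer u zq.1 zq.2).
Proof.
have m11 : measurable_fun setT (fun zq : square * square => zq.1.1).
  exact: (measurableT_comp measurable_fst measurable_fst).
have m12 : measurable_fun setT (fun zq : square * square => zq.1.2).
  exact: (measurableT_comp measurable_snd measurable_fst).
have m21 : measurable_fun setT (fun zq : square * square => zq.2.1).
  exact: (measurableT_comp measurable_fst measurable_snd).
have m22 : measurable_fun setT (fun zq : square * square => zq.2.2).
  exact: (measurableT_comp measurable_snd measurable_snd).
apply: measurable_fun_ifT => //.
  apply: measurable_and; apply: measurable_fun_ltr.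
  - exact: (measurableT_comp measurable_val01 m21).
  - exact: (measurableT_comp mf m11).
  - exact: (measurableT_comp measurable_val01 m22).
  - exact: (measurableT_comp mg m12).
by apply/measurable_EFinP; exact: measurable_graphon_comp.
Qed.

Let measurable_superlevel (h : I01 R -> R) (c : R) : measurable_fun setT h ->
  measurable [set x | c < h x].
Proof.
move=> mh; rewrite (_ : [set _ | _] = setT `&` h @^-1` [set` `]c, +oo[%R]).
  exact: mh.
by apply/seteqP; split=> x /=; rewrite in_itv/= andbT//; case.
Qed.

Let measurable_layer_slice u :
  measurable_fun setT (fun q => \int[lambda2]_z layer u z q)%E.
Proof.
have mL := measurable_layer u.
by apply: (@measurable_fun_fubini_tonelli_G _ _ _ _ R lambda2
  (fun zq => layer u zq.1 zq.2)).
Qed.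

Let layer_cake (u : graphon_fun R) :
  (\int[lambda2]_z (f z.1 * g z.2 * u z.1 z.2)%:E =
    \int[lambda2]_q \int[lambda2]_z layer u z q)%E.
Proof.
have := @fubini_tonelli _ _ _ _ R lambda2 lambda2 (fun zq => layer u zq.1 zq.2).
move=> /(_ (measurable_layer u) (fun zq => layer_ge0 u zq.1 zq.2)) /= <-.
apply: eq_integral => z _.
pose S := [set s | val01 s < f z.1] `*` [set s | val01 s < g z.2].
have mS : measurable S by apply: measurableX; exact: measurable_val01_lt.
rewrite (eq_integral (fun q => (u z.1 z.2)%:E * (\1_S q)%:E)%E); last first.
  move=> q _; rewrite /layer indicE /S; case: ifP => [/andP qS|/negP qS].
    by rewrite mem_set ?mule1//.
  by rewrite memNset ?mule0// => /= /andP.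
rewrite ge0_integralZl_EFin//; last 2 first.
- exact/measurable_EFinP/measurable_indic.
- by case/andP: (graphon_01 u z.1 z.2).
rewrite integral_indic// setIT.
transitivity ((u z.1 z.2)%:E * ((f z.1)%:E * (g z.2)%:E))%E.
  by rewrite -!EFinM mulrC.
rewrite -(lebesgue01_lt (f01 z.1)) -(lebesgue01_lt (g01 z.2)); congr (_ * _)%E.
by apply/esym/product_measure1E; exact: measurable_val01_lt.
Qed.

(** The comparison on rectangles extends to product weights with values in
    [0,1], since these are averages of indicators of rectangles. *)
Lemma cut_le_weighted (eps : R) (u v : graphon_fun R) : 0 <= eps -> cut_le eps u v ->
  (\int[lambda2]_z (f z.1 * g z.2 * u z.1 z.2)%:E <=
   \int[lambda2]_z (f z.1 * g z.2 * v z.1 z.2)%:E + eps%:E)%E.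
Proof.
move=> eps0 uv; rewrite !layer_cake.
have -> : eps%:E = (\int[lambda2]_(q in setT) cst eps%:E q)%E.
  rewrite integral_cst// -[LHS]mule1; congr (_ * _)%E.
  exact/esym/probability_setT.
rewrite -ge0_integralD//; last first.
  by move=> q _; apply: integral_ge0.
apply: ge0_le_integral => //.
- by move=> q _; apply: integral_ge0.
- by apply: emeasurable_funD => //; exact: measurable_cst.
move=> q _.
have E (w : graphon_fun R) : (\int[lambda2]_z layer w z q = \int[lambda2]_(z in
    [set x | (val01 q.1 < f x)%R] `*` [set y | (val01 q.2 < g y)%R])
    (w z.1 z.2)%:E)%E.
  rewrite [RHS]integral_mkcond; apply: eq_integral => z _.
  rewrite patchE /layer; case: ifP => [/andP zq|/negP zq].
    by rewrite mem_set.
  by rewrite memNset// => /= /andP.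
by rewrite !E; apply: uv; exact: measurable_superlevel.
Qed.

End weighted.
End counting.

Section counting_clique.
Context {R : realType} {k : nat}.
Local Notation lambda := (@lebesgue01 R).
Local Notation lambda2 := (lebesgue01_square R).
Implicit Types (W : 'I_k * 'I_k -> graphon_fun R) (t : k.-tuple (I01 R)).

Lemma measurable_tnth_set_tnth t (i a : 'I_k) :
  measurable_fun setT (fun x => tnth (set_tnth t i x) a).
Proof.
rewrite (_ : (fun x => _) = fun x => if a == i then x else tnth t a).
  by case: (a == i) => //; exact: measurable_cst.
by apply/funext => x; rewrite tnth_set_tnth.
Qed.

Lemma measurable_set_tnth2 (i j : 'I_k) : measurable_fun setT
  (fun tz : k.-tuple (I01 R) * (I01 R * I01 R) =>
     set_tnth (set_tnth tz.1 i tz.2.1) j tz.2.2).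
Proof.
have m1 : measurable_fun setT
    (fun tz : k.-tuple (I01 R) * (I01 R * I01 R) => tz.2.1).
  exact: (measurableT_comp measurable_fst measurable_snd).
have m2 : measurable_fun setT
    (fun tz : k.-tuple (I01 R) * (I01 R * I01 R) => tz.2.2).
  exact: (measurableT_comp measurable_snd measurable_snd).
have m3 := measurableT_comp (measurable_set_tnth i)
  (measurable_fun_pair measurable_fst m1).
exact: (measurableT_comp (measurable_set_tnth j) (measurable_fun_pair m3 m2)).
Qed.

Lemma clique_density_resample W (i j : 'I_k) : clique_density W =
  (\int[iid lambda k]_t \int[lambda2]_z
     (edge_prod W (set_tnth (set_tnth t i z.1) j z.2))%:E)%E.
Proof.
have mW := measurable_edge_prod W.
have mF : measurable_fun setT (fun tx : k.-tuple (I01 R) * I01 R =>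
    (edge_prod W (set_tnth tx.1 j tx.2))%:E).
  apply/measurable_EFinP; exact: (measurableT_comp mW (measurable_set_tnth j)).
rewrite /clique_density (integral_resample _ j)//; last 2 first.
- exact/measurable_EFinP.
- by move=> t; rewrite lee_fin edge_prod_ge0.
rewrite (integral_resample _ i)//; last 2 first.
- apply: (measurable_fun_fubini_tonelli_F (m2 := lambda)
    (fun tx => (edge_prod W (set_tnth tx.1 j tx.2))%:E)) => //.
  by move=> tx; rewrite lee_fin edge_prod_ge0.
- by move=> t; apply: integral_ge0 => x _; rewrite lee_fin edge_prod_ge0.
apply: eq_integral => t _; apply/esym.
apply: (@fubini_tonelli1 _ _ _ _ R lambda lambda
  (fun z => (edge_prod W (set_tnth (set_tnth t i z.1) j z.2))%:E)).
  apply/measurable_EFinP.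
  have mz := measurableT_comp (measurable_set_tnth2 i j)
    (@pair1_measurable _ _ _ (I01 R * I01 R)%type t).
  exact: (measurableT_comp mW mz).
by move=> z; rewrite lee_fin edge_prod_ge0.
Qed.

(** When all points but X_i and X_j are frozen, the factors other than the one of
    the pair (i, j) form a function of X_i times a function of X_j, because no
    other pair contains both i and j. *)
Lemma clique_density_swap (eps : R) W W' (e0 : 'I_k * 'I_k) : 0 <= eps ->
  cut_le eps (W e0) (W' e0) -> (forall e, e != e0 -> W e = W' e) ->
  (clique_density W <= clique_density W' + eps%:E)%E.
Proof.
move=> eps0 cutW WW'; have [e0lt|e0ge] := boolP (e0.1 < e0.2)%N; last first.
  rewrite (_ : clique_density W = clique_density W') ?leeDl ?lee_fin//.
  apply: eq_integral => t _; congr (_%:E); apply: eq_bigr => e elt.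
  by rewrite WW'//; apply: contraNneq e0ge => <-.
pose i := e0.1; pose j := e0.2.
pose M := (fun t (z : I01 R * I01 R) => set_tnth (set_tnth t i z.1) j z.2).
pose slice V t := (\int[lambda2]_z (edge_prod V (M t z))%:E)%E.
have mslice V : measurable_fun setT (slice V).
  apply: (@measurable_fun_fubini_tonelli_F _ _ _ _ R lambda2
      (fun tz => (edge_prod V (M tz.1 tz.2))%:E)).
    apply/measurable_EFinP.
    exact: (measurableT_comp (measurable_edge_prod V) (measurable_set_tnth2 i j)).
  by move=> tz; rewrite lee_fin edge_prod_ge0.
have slice_ge0 V t : (0 <= slice V t)%E.
  by apply: integral_ge0 => z _; rewrite lee_fin edge_prod_ge0.
(* The factors of the pairs that contain j are put in the weight of X_j, all
   the others in the weight of X_i. *)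
pose touches (e : 'I_k * 'I_k) := (e.1 == j) || (e.2 == j).
pose side l t x : R := \prod_(e : 'I_k * 'I_k | ((e.1 < e.2)%N && (e != e0)) &&
  (if l then ~~ touches e else touches e))
  W e (tnth (set_tnth t (if l then i else j) x) e.1)
      (tnth (set_tnth t (if l then i else j) x) e.2).
have side01 l t x : 0 <= side l t x <= 1.
  apply/andP; split.
    by apply: prodr_ge0 => e _; case/andP: (graphon_01 (W e)
      (tnth (set_tnth t (if l then i else j) x) e.1)
      (tnth (set_tnth t (if l then i else j) x) e.2)).
  by apply: prodr_ile1 => e _; exact: graphon_01.
have mside l t : measurable_fun setT (side l t).
  rewrite /side; under eq_fun do rewrite big_mkcond.
  apply: measurable_prod => e _; case: (_ && _); last exact: measurable_cst.
  by apply: measurable_graphon_comp; exact: measurable_tnth_set_tnth.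
have split V t z : (forall e, e != e0 -> W e = V e) ->
    edge_prod V (M t z) = side true t z.1 * side false t z.2 * V e0 z.1 z.2.
  move=> WV; rewrite /edge_prod (bigD1 e0)//= mulrC.
  have ij : i == j = false by rewrite -val_eqE ltn_eqF.
  congr (_ * _); last by rewrite /M !tnth_set_tnth !eqxx ij.
  rewrite (bigID touches)/= mulrC; congr (_ * _).
    apply: eq_bigr => e /andP[/andP[_ ee0] /norP[/negbTE e1 /negbTE e2]].
    by rewrite -WV// /M ![tnth (set_tnth _ j _) _]tnth_set_tnth e1 e2.
  apply: eq_bigr => e /andP[/andP[elt ee0] ej].
  (* A pair other than (i, j) that contains j does not contain i. *)
  have e1i : e.1 == i = false.
    apply: contraNF ee0 => /eqP e1i; move: ej.
    rewrite /touches e1i ij/= => /eqP e2j; apply/eqP.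
    by rewrite (surjective_pairing e) (surjective_pairing e0) e1i e2j.
  have e2i : e.2 == i = false.
    apply: contraTF elt => /eqP e2i; move: ej.
    rewrite /touches e2i ij orbF => /eqP ->.
    by rewrite -leqNgt ltnW.
  by rewrite -WV// /M !tnth_set_tnth e1i e2i.
have densE V : clique_density V = (\int[iid lambda k]_t slice V t)%E.
  exact: clique_density_resample.
rewrite !densE.
have -> : eps%:E = (\int[iid lambda k]_(t in setT) cst eps%:E t)%E.
  rewrite integral_cst// -[LHS]mule1; congr (_ * _)%E.
  exact/esym/probability_setT.
rewrite -ge0_integralD//.
apply: ge0_le_integral => //.
- by apply: emeasurable_funD => //; exact: measurable_cst.
move=> t _; rewrite /slice.
under eq_integral do rewrite split//.
under [X in (_ <= X + _)%E]eq_integral do rewrite split//.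
exact: cut_le_weighted.
Qed.

Lemma cut_le_refl (eps : R) (u : graphon_fun R) : 0 <= eps -> cut_le eps u u.
Proof. by move=> eps0 S T mS mT; rewrite leeDl ?lee_fin. Qed.

Lemma clique_density_cut_le (eps : R) (u v : graphon_fun R) : 0 <= eps ->
  cut_le eps u v ->
  (clique_density (fun _ : 'I_k * 'I_k => u) <=
   clique_density (fun _ : 'I_k * 'I_k => v) + ((k * k)%:R * eps)%:E)%E.
Proof.
move=> eps0 cutuv.
pose hybrid (s : seq ('I_k * 'I_k)) e := if e \in s then v else u.
have step s : (clique_density (fun _ : 'I_k * 'I_k => u) <=
    clique_density (hybrid s) + ((size s)%:R * eps)%:E)%E.
  elim: s => [|e s IH]; first by rewrite mul0r adde0; exact: lexx.
  apply: le_trans IH _.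
  rewrite (_ : (size (e :: s))%:R * eps = eps + (size s)%:R * eps); last first.
    by rewrite -[size _]/(size s).+1 -natr1 mulrDl mul1r addrC.
  rewrite EFinD addeA; apply: leeD; last exact: lexx.
  apply: (clique_density_swap (e0 := e)) => //.
    by rewrite /hybrid mem_head; case: ifP => // _; exact: cut_le_refl.
  by move=> e' /negbTE e'e; rewrite /hybrid inE e'e.
have := step (enum {: 'I_k * 'I_k}); rewrite -cardE card_prod card_ord.
rewrite (_ : hybrid _ = fun=> v)//.
by apply/funext => e; rewrite /hybrid mem_enum.
Qed.

Lemma integrable_graphon (u : graphon_fun R) (S T : set (I01 R)) :
  measurable S -> measurable T ->
  lambda2.-integrable (S `*` T) (EFin \o (fun z => u z.1 z.2)).
Proof.
move=> mS mT; apply: measurable_bounded_integrable.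
- exact: measurableX.
- by apply: le_lt_trans (ltry 1); apply: probability_le1; exact: measurableX.
- by apply: measurable_funTS; exact: graphon_measurable.
- exists 1; split=> // M M1 z _ /=.
  have /andP[u0 u1] := graphon_01 u z.1 z.2.
  by rewrite ger0_norm// (le_trans u1)// ltW.
Qed.

Lemma cut_norm_cut_le (eps : R) (u v : graphon_fun R) :
  (cut_norm (fun x y => (u x y - v x y)%R) <= eps%:E)%E ->
  cut_le eps u v /\ cut_le eps v u.
Proof.
move=> uv.
have diff S T : measurable S -> measurable T ->
    (`|\int[lambda2]_(z in S `*` T) (u z.1 z.2)%:E -
       \int[lambda2]_(z in S `*` T) (v z.1 z.2)%:E| <= eps%:E)%E.
  move=> mS mT; apply: le_trans uv; apply: ereal_sup_ubound; exists (S, T) => //=.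
  rewrite -integralB_EFin//; try exact: integrable_graphon.
  exact: measurableX.
have fin (w : graphon_fun R) S T : measurable S -> measurable T ->
    (\int[lambda2]_(z in S `*` T) (w z.1 z.2)%:E)%E \is a fin_num.
  move=> mS mT; apply: integrable_fin_num (integrable_graphon w mS mT).
  exact: measurableX.
split=> S T mS mT; rewrite -leeBlDl ?fin//; apply: le_trans (diff S T mS mT).
  exact: lee_abs.
by rewrite -abseN fin_num_oppeB ?fin// addeC; exact: lee_abs.
Qed.

End counting_clique.

(** * Rearranging a graphon *)

Section pullback.
Context {R : realType} (w : graphon_fun R) (phi : I01 R -> I01 R).
Hypothesis mphi : measurable_fun setT phi.

Let pullback_measurable : measurable_fun setT (fun z => w (phi z.1) (phi z.2)).
Proof.
apply: measurable_graphon_comp.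
- exact: (measurableT_comp mphi measurable_fst).
- exact: (measurableT_comp mphi measurable_snd).
Qed.

Let pullback_sym x y : w (phi x) (phi y) = w (phi y) (phi x).
Proof. exact: graphon_sym. Qed.

Let pullback_01 x y : 0 <= w (phi x) (phi y) <= 1.
Proof. exact: graphon_01. Qed.

Definition pullback : graphon_fun R :=
  GraphonFun pullback_measurable pullback_sym pullback_01.

Lemma clique_density_pullback (k : nat) :
  (forall A, measurable A -> lebesgue01 (phi @^-1` A) = lebesgue01 A) ->
  clique_density (fun _ : 'I_k * 'I_k => pullback) =
  clique_density (fun _ : 'I_k * 'I_k => w).
Proof.
move=> phi_pres; pose f (t : k.-tuple (I01 R)) := [tuple of map phi t].
have mf : measurable_fun setT f by exact: measurable_map_tuple.
have mE : measurable_fun setT (fun t : k.-tuple (I01 R) =>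
    (edge_prod (fun=> w) t)%:E).
  by apply/measurable_EFinP; exact: measurable_edge_prod.
rewrite /clique_density; transitivity (\int[pushforward (iid lebesgue01 k) f]_t
    (edge_prod (fun=> w) t)%:E)%E.
  rewrite ge0_integral_pushforward//; last first.
    by move=> t _; rewrite lee_fin edge_prod_ge0.
  apply: eq_integral => t _ /=; congr (_%:E); apply: eq_bigr => e _.
  by rewrite /= !tnth_map.
apply: eq_measure_integral => // A mA _.
exact: (iid_map mphi phi_pres).
Qed.

End pullback.

(** * The permutation that reverses an order *)

Section reversing_permutation.
Context {R : realDomainType} {k : nat}.
Implicit Types (a b : 'I_k -> R) (s : {perm 'I_k}).

Definition rank a (i : 'I_k) : nat := #|[set j | a j < a i]%SET|.

Lemma rank_mono a i j : (rank a i < rank a j)%N = (a i < a j).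
Proof.
have [ij|ji] := ltP (a i) (a j); last first.
  apply/negbTE; rewrite -leqNgt; apply/subset_leq_card/fintype.subsetP => l.
  by rewrite !inE => /lt_le_trans; apply.
apply/proper_card/fintype.properP; split; last by exists i; rewrite !inE ?ltxx.
by apply/fintype.subsetP => l; rewrite !inE => /lt_trans; apply.
Qed.

Lemma rank_opp_mono b i j :
  (rank (fun l => - b l) i < rank (fun l => - b l) j)%N = (b j < b i).
Proof. by rewrite rank_mono ltrN2. Qed.

Lemma rank_lt a i : (rank a i < k)%N.
Proof.
rewrite -[X in (_ < X)%N]card_ord -cardsT; apply/proper_card/fintype.properP.
by split; [exact: finset.subsetT|exists i; rewrite !inE ?ltxx].
Qed.

Lemma rank_perm a : injective a ->
  exists s : {perm 'I_k}, forall i, s i = rank a i :> nat.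
Proof.
move=> inja; have inj_rank : injective (fun i => Ordinal (rank_lt a i)).
  move=> i j /(congr1 val)/= ij; apply/inja/eqP; rewrite eq_le !leNgt -!rank_mono.
  by rewrite ij ltnn.
by exists (perm inj_rank) => i; rewrite permE.
Qed.

Definition reversing a b s : Prop :=
  forall i j, i != j -> (a i - a j) * (b (s i) - b (s j)) < 0.

(** Match the rank of a with the rank of - b. *)
Lemma reversing_exists a b : injective a -> injective b ->
  exists s, reversing a b s.
Proof.
move=> inja injb; have [ra raE] := rank_perm inja.
have [rb rbE] : exists s : {perm 'I_k},
    forall i, s i = rank (fun i => - b i) i :> nat.
  by apply: rank_perm => i j /oppr_inj/injb.
exists (ra * rb^-1)%g => i j ij.
have sE l : rb ((ra * rb^-1)%g l) = ra l by rewrite permM permKV.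
have ord_iff l m : (a l < a m) = (b ((ra * rb^-1)%g m) < b ((ra * rb^-1)%g l)).
  by rewrite -(rank_opp_mono b) -!rbE !sE !raE rank_mono.
have [aij|aji|/inja/eqP] := ltgtP (a i) (a j); last by rewrite (negbTE ij).
- by rewrite nmulr_rlt0 ?subr_lt0// subr_gt0 -ord_iff.
- by rewrite pmulr_rlt0 ?subr_gt0// subr_lt0 -ord_iff.
Qed.

Lemma reversing_lt a b s i j : reversing a b s ->
  (b (s i) < b (s j)) = (a j < a i).
Proof.
move=> rev; have [->|ij] := eqVneq i j; first by rewrite !ltxx.
have := rev _ _ ij; have [aij|aji|aij] := ltgtP (a i) (a j).
- rewrite nmulr_rlt0 ?subr_lt0// subr_gt0 => bji.
  by apply/negbTE; rewrite -leNgt ltW.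
- by rewrite pmulr_rlt0 ?subr_gt0// subr_lt0.
- by rewrite aij subrr mul0r ltxx.
Qed.

(** A reversing permutation s sends i to the index whose rank for - b is the rank
    of i for a, and this index is unique because b is injective as soon as some
    reversing permutation exists. *)
Lemma reversing_unique a b s s' : reversing a b s -> reversing a b s' -> s = s'.
Proof.
move=> rs rs'.
have rankE u : reversing a b u -> forall i, rank (fun i => - b i) (u i) = rank a i.
  move=> ru i; rewrite /rank -[RHS](card_imset _ (@perm_inj _ u)).
  apply: eq_card => l.
  rewrite inE ltrN2 -{1}[l](permKV u) (reversing_lt _ _ ru).
  apply/idP/imsetP => [al|[j + ->]]; last by rewrite inE permK.
  by exists (u^-1 l)%g; rewrite ?inE ?permKV.
have injb : injective b.
  move=> l m blm; apply/eqP/negPn/negP => lm.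
  have := rs (s^-1 l)%g (s^-1 m)%g.
  by rewrite (inj_eq perm_inj) !permKV blm subrr mulr0 ltxx => /(_ lm).
apply/permP => i; apply/injb/eqP; rewrite eq_le !leNgt.
by rewrite -!(rank_opp_mono b) !rankE// ltnn.
Qed.

End reversing_permutation.

(** * Cliques in the permutation graphon *)

Section permutation_cliques.
Context {R : realType} {k : nat}.
Local Notation lambda := (@lebesgue01 R).
Local Notation lambda2 := (lebesgue01_square R).
Local Notation point := (I01 R * I01 R)%type.
Local Notation mu := (iid lambda2 k).
Implicit Types (t : k.-tuple point) (i j : 'I_k) (s : {perm 'I_k}).

Definition abscissa t i : R := val01 (tnth t i).1.
Definition ordinate t i : R := val01 (tnth t i).2.

Definition reversed s : set (k.-tuple point) :=
  [set t | reversing (abscissa t) (ordinate t) s].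

Lemma measurable_abscissa i : measurable_fun setT (fun t => abscissa t i).
Proof.
have m1 := measurableT_comp (@measurable_fst _ _ (I01 R) (I01 R))
  (measurable_tnth i).
exact: (measurableT_comp measurable_val01 m1).
Qed.

Lemma measurable_ordinate i : measurable_fun setT (fun t => ordinate t i).
Proof.
have m2 := measurableT_comp (@measurable_snd _ _ (I01 R) (I01 R))
  (measurable_tnth i).
exact: (measurableT_comp measurable_val01 m2).
Qed.

Lemma measurable_reversed s : measurable (reversed s).
Proof.
pose A (e : 'I_k * 'I_k) := if e.1 == e.2 then [set: k.-tuple point] else
  setT `&` (fun t => (abscissa t e.1 - abscissa t e.2) *
    (ordinate t (s e.1) - ordinate t (s e.2)) < 0) @^-1` [set true].
rewrite (_ : reversed s = \bigcap_(e in setT) A e).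
  apply: fin_bigcap_measurable => // e _; rewrite /A; case: ifP => // _.
  apply: measurable_fun_ltr => //; apply: measurable_funM;
    apply: measurable_funB; by [exact: measurable_abscissa|exact: measurable_ordinate].
apply/seteqP; split=> [t rt [i j] _|t At i j ij].
  by rewrite /A/=; case: ifPn => // ij; split=> //=; exact: rt.
by have := At (i, j) I; rewrite /A/= (negbTE ij) => -[].
Qed.

(** Keeps the abscissas and permutes the ordinates. *)
Definition recombine s t : k.-tuple point :=
  [tuple ((tnth t i).1, (tnth t (s i)).2) | i < k].

(** It suffices to test boxes whose sides are rectangles B_i x C_i, and the
    ordinates permuted by s lie in the C_i iff the original ones lie in the
    C_(s^-1 i): the product of the masses is the same up to reindexing. *)
Lemma iid_recombine s (E : set (k.-tuple point)) : measurable E ->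
  mu (recombine s @^-1` E) = mu E.
Proof.
move: E; apply: (iid_pushforward
  (G := [set A `*` B | A in measurable & B in measurable])).
- apply/measurable_fun_tnthP => i.
  rewrite (_ : _ \o _ = fun t => ((tnth t i).1, (tnth t (s i)).2)); last first.
    by apply/funext => t; rewrite /= tnth_mktuple.
  apply: measurable_fun_pair.
  + exact: (measurableT_comp measurable_fst (measurable_tnth i)).
  + exact: (measurableT_comp measurable_snd (measurable_tnth (s i))).
- exact: measurable_prod_measurableType.
- move=> _ _ [A mA [B mB <-]] [C mC [D mD <-]]; rewrite -setXI.
  by exists (A `&` C); [exact: measurableI|exists (B `&` D); [exact: measurableI|]].
- by exists setT => //; exists setT => //; rewrite setXTT.
move=> A GA.
have /choice[BC BCE] i : exists BC : set (I01 R) * set (I01 R),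
    [/\ measurable BC.1, measurable BC.2 & BC.1 `*` BC.2 = A i].
  by have [B mB [C mC <-]] := GA i; exists (B, C).
pose B i := (BC i).1; pose C i := (BC i).2.
have mB i : measurable (B i) by case: (BCE i).
have mC i : measurable (C i) by case: (BCE i).
have AE i : A i = B i `*` C i by case: (BCE i).
have lambda2X (X Y : set (I01 R)) : measurable X -> measurable Y ->
  lambda2 (X `*` Y) = (lambda X * lambda Y)%E.
  by move=> mX mY; exact: product_measure1E.
transitivity (mu (box (fun i => B i `*` C (s^-1 i)%g))).
  congr (mu _); apply/seteqP; split=> t At i.
    split; first by have := At i; rewrite tnth_mktuple AE => -[].
    by have := At (s^-1 i)%g; rewrite tnth_mktuple AE permKV => -[].
  rewrite tnth_mktuple AE; split; first by case: (At i).
  by have := At (s i); rewrite permK => -[].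
rewrite [LHS]iid_box; last by move=> i; exact: measurableX.
under eq_bigr do rewrite lambda2X//.
under [RHS]eq_bigr do rewrite AE lambda2X//.
rewrite !big_split/=; congr (_ * _)%E.
by rewrite [RHS](reindex_inj (@perm_inj _ s^-1%g)).
Qed.

Lemma measure_reversed s : mu (reversed s) = mu (reversed 1%g).
Proof.
rewrite -(iid_recombine s (measurable_reversed 1%g)).
congr (mu _); apply/seteqP; split=> t rt i j ij; have := rt i j ij;
  by rewrite /abscissa /ordinate !tnth_mktuple !perm1.
Qed.

Lemma measurable_val01_fiber (c : R) : measurable [set u : I01 R | val01 u = c].
Proof.
rewrite (_ : [set _ | _] = setT `&` val01 @^-1` [set c]); last by rewrite setTI.
exact: measurable_val01.
Qed.

Lemma lebesgue01_fiber (c : R) : lambda [set u | val01 u = c] = 0%E.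
Proof.
rewrite /lebesgue01 [X in lebesgue_measure X](val01_image_preimage [set c]).
apply/eqP; rewrite eq_le measure_ge0 andbT -(lebesgue_measure_set1 c).
by apply: le_measure; rewrite ?inE//; exact: measurableI.
Qed.

(** Resample the i-th point: it then has to hit the fiber of p through the j-th
    one, a null set. *)
Lemma coincidence_null (p : point -> R) i j : measurable_fun setT p ->
  (forall c : R, lambda2 [set x | p x = c] = 0%E) -> i != j ->
  mu [set t | p (tnth t i) = p (tnth t j)] = 0%E.
Proof.
move=> mp p0 ij.
have mE : measurable [set t | p (tnth t i) = p (tnth t j)].
  rewrite (_ : [set _ | _] =
    setT `&` (fun t => p (tnth t i) == p (tnth t j)) @^-1` [set true]).
    apply: measurable_fun_eqr => //;
    exact: (measurableT_comp mp (measurable_tnth _)).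
  by apply/seteqP; split=> t /=; [move=> /eqP|move=> [_ /eqP]].
rewrite -(iid_resample _ i mE); apply: integral0_eq => t _ /=.
rewrite -[RHS](p0 (p (tnth t j))); congr (lambda2 _); apply/seteqP; split=> x.
  by rewrite /xsection/= inE/= !tnth_set_tnth eqxx eq_sym (negbTE ij).
by move=> px; rewrite /xsection/= inE/= !tnth_set_tnth eqxx eq_sym (negbTE ij).
Qed.

Lemma abscissa_coincidence_null i j : i != j ->
  mu [set t | abscissa t i = abscissa t j] = 0%E.
Proof.
apply: (coincidence_null (p := fun x => val01 x.1)) => [|c].
  exact: (measurableT_comp measurable_val01 measurable_fst).
rewrite (_ : [set _ | _] = [set u | val01 u = c] `*` setT); last first.
  by apply/seteqP; split=> x //= -[].
transitivity (lambda [set u | val01 u = c] * lambda setT)%E.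
  by apply: product_measure1E => //; exact: measurable_val01_fiber.
by rewrite lebesgue01_fiber mul0e.
Qed.

Lemma ordinate_coincidence_null i j : i != j ->
  mu [set t | ordinate t i = ordinate t j] = 0%E.
Proof.
apply: (coincidence_null (p := fun x => val01 x.2)) => [|c].
  exact: (measurableT_comp measurable_val01 measurable_snd).
rewrite (_ : [set _ | _] = setT `*` [set u | val01 u = c]); last first.
  by apply/seteqP; split=> x //= -[].
transitivity (lambda setT * lambda [set u | val01 u = c])%E.
  by apply: product_measure1E => //; exact: measurable_val01_fiber.
by rewrite lebesgue01_fiber mule0.
Qed.

Lemma measurable_coincidence (p : k.-tuple point -> 'I_k -> R) i j :
  (forall l, measurable_fun setT (fun t => p t l)) ->
  measurable [set t | p t i = p t j].
Proof.
move=> mp; rewrite (_ : [set _ | _] =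
  setT `&` (fun t => p t i == p t j) @^-1` [set true]).
  exact: measurable_fun_eqr.
by apply/seteqP; split=> t /=; [move=> /eqP|move=> [_ /eqP]].
Qed.

(** Outside the events where two points share an abscissa or an ordinate, a
    reversing permutation exists. *)
Lemma reversed_cover : mu (\bigcup_(s in setT) reversed s) = 1%E.
Proof.
set U := \bigcup_(s in _) _.
have mU : measurable U.
  apply: fin_bigcup_measurable => [|s _]; first exact: finite_finset.
  exact: measurable_reversed.
pose N (e : 'I_k * 'I_k) := [set t | abscissa t e.1 = abscissa t e.2] `|`
                            [set t | ordinate t e.1 = ordinate t e.2].
have mx (e : 'I_k * 'I_k) := measurable_coincidence e.1 e.2 measurable_abscissa.
have my (e : 'I_k * 'I_k) := measurable_coincidence e.1 e.2 measurable_ordinate.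
have : (mu (~` U) <= \sum_(e \in [set e : 'I_k * 'I_k | e.1 != e.2]) mu (N e))%E.
  apply: content_sub_fsum.
  - exact: finite_finset.
  - by move=> e _; exact: measurableU.
  - exact: measurableC.
  move=> t; apply: contra_notP => Nt.
  have inj (p : k.-tuple point -> 'I_k -> R) :
      (forall i j, p t i = p t j -> i != j -> N (i, j) t) -> injective (p t).
    move=> pN i j pij; apply/eqP/negPn/negP => ij; apply: Nt.
    by exists (i, j) => //; exact: pN.
  have injx : injective (abscissa t) by apply: inj => i j pij _; left.
  have injy : injective (ordinate t) by apply: inj => i j pij _; right.
  by have [s rs] := reversing_exists injx injy; exists s.
rewrite fsbig1 => [|e e12]; last first.
  apply: null_set_setU => //.
  - exact: abscissa_coincidence_null.
  - exact: ordinate_coincidence_null.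
move=> C0; have {}C0 : mu (~` U) = 0%E.
  by apply/eqP; rewrite eq_le C0 measure_ge0.
by rewrite -[U]setCK probability_setC ?C0 ?sube0//; exact: measurableC.
Qed.

(** The k! events reversed s are disjoint, equally likely and of total mass 1. *)
Lemma measure_reversed1 : mu (reversed 1%g) = (k`!%:R^-1)%:E.
Proof.
have := reversed_cover; rewrite measure_fin_bigcup; last 3 first.
- exact: finite_finset.
- move=> s s' _ _ [t [rs rs']]; exact: reversing_unique rs rs'.
- by move=> s _; exact: measurable_reversed.
rewrite (eq_fsbigr (fun=> mu (reversed 1%g))); last first.
  by move=> s _; exact: measure_reversed.
have <- : (fine (mu (reversed 1%g)))%:E = mu (reversed 1%g).
  by rewrite fineK// fin_num_measure//; exact: measurable_reversed.
rewrite (_ : [set: {perm 'I_k}] = [set` enum {perm 'I_k}]); last first.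
  by apply/seteqP; split=> s //= _; rewrite mem_enum.
rewrite -fsbig_seq ?enum_uniq// big_enum/= sumEFin sumr_const card_Sn => -[kp].
have k0 : k`!%:R != 0 :> R by rewrite pnatr_eq0 -lt0n fact_gt0.
by congr (_%:E); apply: (mulfI k0); rewrite divff// mulr_natl.
Qed.

Lemma clique_density_perm (Psi : {mfun I01 R >-> point}) :
  (forall A : set point, measurable A ->
     pushforward lambda Psi A = (lambda \x lambda)%E A) ->
  clique_density (fun _ : 'I_k * 'I_k => perm_graphon Psi) = (k`!%:R^-1)%:E.
Proof.
move=> Psi_law; rewrite -measure_reversed1.
have mPsi : measurable_fun setT Psi by exact: measurable_funP.
have mrev := measurable_reversed 1%g.
rewrite -(iid_map (P := lambda) (Q := lambda2) mPsi Psi_law mrev).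
set E := (X in iid _ _ X).
have mE : measurable E.
  by rewrite -[E]setTI; exact: measurable_map_tuple.
rewrite -[in RHS](setIT E) -integral_indic//; apply: eq_integral => t _.
congr (_%:E); rewrite indicE /edge_prod /= /perm_fun.
pose inv (i j : 'I_k) := (val01 (Psi (tnth t i)).1 - val01 (Psi (tnth t j)).1) *
    (val01 (Psi (tnth t i)).2 - val01 (Psi (tnth t j)).2) < 0.
have invC i j : inv i j = inv j i by rewrite /inv -mulrNN !opprB.
have EP : E t <-> forall i j, i != j -> inv i j.
  split=> Et i j ij; have := Et i j ij;
    by rewrite /inv /abscissa /ordinate !tnth_map !perm1.
have [Et|Et] := pselect (E t).
  rewrite mem_set// big1// => -[i j]/= ij; rewrite -[X in nat_of_bool X]/(inv i j).
  by move/EP : Et => ->//; rewrite -val_eqE/= ltn_eqF.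
have [i [j [ij nij]]] : exists i j : 'I_k, (i < j)%N /\ ~~ inv i j.
  apply: contra_notP Et => H; apply/EP => i j ij.
  apply/negPn/negP => nij; apply: H.
  have [lij|lji|/val_inj eij] := ltngtP i j; last by rewrite eij eqxx in ij.
    by exists i, j.
  by exists j, i; rewrite invC.
rewrite memNset// (bigD1 (i, j))//= -[X in nat_of_bool X]/(inv i j) (negbTE nij).
by rewrite mul0r.
Qed.

End permutation_cliques.

Theorem proposition4p8 (R : realType)
    (Psi : {mfun I01 R >-> (I01 R * I01 R)%type})
    (Psi_pushes_lebesgue : forall A : set (I01 R * I01 R), measurable A ->
      pushforward lebesgue01 Psi A = (lebesgue01 \x lebesgue01)%E A)
    (w : graphon_fun R) (w_repr : graphon_of (perm_graphon Psi) w)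
    (k : nat) (k_ge1 : (1 <= k)%N) :
  Dens (complete_graph k) w = (k`!%:R^-1 : R)%:E.
Proof.
rewrite Dens_complete_graph -(clique_density_perm (k := k) Psi_pushes_lebesgue).
have kk0 : 0 < (k * k)%:R :> R by rewrite ltr0n muln_gt0 k_ge1.
(* By the counting lemma, the density changes by at most k^2 times the cut norm,
   hence the tolerance e / k^2. *)
have close (e : R) : 0 < e -> exists2 w' : graphon_fun R,
    clique_density (fun _ : 'I_k * 'I_k => w') =
    clique_density (fun _ : 'I_k * 'I_k => w) &
    cut_le (e / (k * k)%:R) (perm_graphon Psi) w' /\
    cut_le (e / (k * k)%:R) w' (perm_graphon Psi).
  move=> e0; have d0 : 0 < e / (k * k)%:R by rewrite divr_gt0.
  move: w_repr; rewrite /graphon_of/= /cut_distance.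
  set S := (X in ereal_inf X) => inf0.
  have fin_inf : ereal_inf S \is a fin_num by rewrite inf0.
  have [_ [phi [mphi _ phi_pres] <-]] := lb_ereal_inf_adherent d0 fin_inf.
  rewrite inf0 add0e => /ltW cut_small.
  exists (pullback w mphi); first exact: clique_density_pullback.
  exact: cut_norm_cut_le.
have eE (e : R) : (k * k)%:R * (e / (k * k)%:R) = e.
  by rewrite mulrC divfK// gt_eqF.
apply/eqP; rewrite eq_le; apply/andP; split; apply/lee_addgt0Pr => e e0.
  have [w' <- [_ w'P]] := close e e0; rewrite -[in leRHS](eE e).
  by apply: clique_density_cut_le => //; rewrite divr_ge0// ltW.
have [w' <- [Pw' _]] := close e e0; rewrite -[in leRHS](eE e).
by apply: clique_density_cut_le => //; rewrite divr_ge0// ltW.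
Qed.
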